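(* Let $g,h:\mathbb{R}^n\to\mathbb{R}\cup\{+\infty\}$ be lower semicontinuous convex functions, and suppose that $\alpha=\inf\{f(x)=g(x)-h(x):x\in\mathbb{R}^n\}>-\infty$. Let $\{x^k\}$ be a sequence generated by Algorithm 1 (described in the context). Then: (a) For all $k\in\mathbb{N}$, with $\rho_k:=\min_{i\in I(x^k)}\rho(h_i)$, $$f(x^{k+1})\le f(x^k)-\frac{\rho_k}{2}\|x^{k+1}-x^k\|^2 .$$ As a result, $\{f(x^k)\}$ is a decreasing sequence. If $\inf_{k\in\mathbb{N}}\rho_k=:\rho>0$, then $\lim_{k\to\infty}\|x^{k+1}-x^k\|=0$. (b) If $\sup_{k\in\mathbb{N}}\max_{i\in I(x^k)}\|\nabla h_i(x^k)\|<+\infty$, then any limit point of $\{x^k\}$ at which $h$ is continuous is a DC-critical point of $(P)$. (c) Let $x^\infty$ be a limit point of $\{x^k\}$ at which $h$ is continuous. If for every $x\in\mathbb{R}^n$ there is a subsequence $\{x^{l_k}\}$ converging to $x^\infty$ such that $$\limsup_{k\to\infty}\max_{i\in I(x^{l_k})}\left[\langle\nabla h_i(x^{l_k}),x-x^{l_k}\rangle+h_i(x^{l_k})\right]\ge h'(x^\infty,x-x^\infty)+h(x^\infty),$$ then $x^\infty$ is a directional stationary point of $(P)$.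
   Context: Problem $(P)$: minimize $f(x)=g(x)-h(x)$ over $x\in\mathbb{R}^n$, with the convention $(+\infty)-(+\infty)=+\infty$. The optimal value $\alpha$ is assumed finite, which implies $\operatorname{dom}g\subseteq\operatorname{dom}h$. $\partial\varphi$ denotes the convex subdifferential, $\operatorname{dom}(\partial\varphi)=\{x:\partial\varphi(x)\ne\emptyset\}$, and $\varphi'(x,d)=\lim_{t\to0^+}\frac{\varphi(x+td)-\varphi(x)}{t}$. The convexity modulus $\rho(\varphi)\ge0$ of a convex function $\varphi$ is the supremum of all $\rho\ge0$ such that $\varphi(\lambda x+(1-\lambda)y)\le\lambda\varphi(x)+(1-\lambda)\varphi(y)-\frac{\rho}{2}\lambda(1-\lambda)\|x-y\|^2$ for all $x,y\in\mathbb{R}^n$, $\lambda\in[0,1]$. Algorithm 1. Start with $x^0\in\operatorname{dom}(\partial h)$. For $k=0,1,\dots$: 1. Pick a finite family of differentiable convex functions $h_i:\mathbb{R}^n\to\mathbb{R}$, $i\in I(x^k)$, where $I(x^k)$ is a finite index set (the family may depend on $k$), such that $\max_{i\in I(x^k)}h_i(x^k)=h(x^k)$ and $\max_{i\in I(x^k)}h_i(x)\le h(x)$ for all $x\in\mathbb{R}^n$. 2. For each $i\in I(x^k)$ compute a solution $x^{k+1}_i$ of the convex program $\min\{g(x)-\langle\nabla h_i(x^k),x\rangle:x\in\mathbb{R}^n\}$. 3. Set $x^{k+1}:=x^{k+1}_{i}$ for an index $i\in I(x^k)$ minimizing $g(x^{k+1}_i)-\langle\nabla h_i(x^k),x^{k+1}_i-x^k\rangle-h_i(x^k)$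 over $I(x^k)$. A sequence generated by Algorithm 1 is an infinite sequence produced in this way (in particular all subproblems are solvable). ''Decreasing'' means $f(x^{k+1})\le f(x^k)$. A DC-critical point of $(P)$ is a point $x$ with $\partial g(x)\cap\partial h(x)\ne\emptyset$. A directional stationary point of $(P)$ is a point $x$ (with $f(x)$ finite) such that $f'(x,d)=g'(x,d)-h'(x,d)\ge0$ for all $d\in\mathbb{R}^n$. *)

(* Defs.v *)
From HB Require Import structures.
From mathcomp Require Export all_boot all_order all_algebra.
From mathcomp Require Export all_classical all_reals all_analysis.

Set Implicit Arguments.
Unset Strict Implicit.
Unset Printing Implicit Defensive.

Export Order.TTheory GRing.Theory Num.Theory.
Export numFieldNormedType.Exports.

Local Open Scope classical_set_scope.
Local Open Scope ring_scope.
Local Open Scope ereal_scope.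

(* The norm that the library puts on 'rV[R]_n is the sup norm: it induces the
   usual topology, but the Euclidean norm has to be defined. *)
Definition dotp (R : realType) (n : nat) (u v : 'rV[R]_n) : R :=
  (\sum_(j < n) u ord0 j * v ord0 j)%R.

Definition enorm (R : realType) (n : nat) (u : 'rV[R]_n) : R :=
  Num.sqrt (dotp u u).

Definition grad (R : realType) (n : nat) (f : 'rV[R]_n -> R) (x : 'rV[R]_n) :
  'rV[R]_n := \row_(j < n) 'D_(delta_mx ord0 j) f x.

(* Functions into R `|` {+oo} are functions into \bar R that avoid -oo. In the
   next two definitions 0 * +oo = 0, so the cases t = 0 and t = 1 are harmless. *)
Definition convex_efun (R : realType) (n : nat) (phi : 'rV[R]_n -> \bar R) :
  Prop :=
  forall (x y : 'rV[R]_n) (t : R), (0 <= t <= 1)%R ->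
    phi (t *: x + (1 - t) *: y)%R <= t%:E * phi x + (1 - t)%:E * phi y.

(* The supremum is taken in \bar R (it is +oo when n = 0). *)
Definition convexity_modulus (R : realType) (n : nat)
  (phi : 'rV[R]_n -> \bar R) : \bar R :=
  ereal_sup [set r%:E | r in [set r : R | (0 <= r)%R /\
    forall (x y : 'rV[R]_n) (t : R), (0 <= t <= 1)%R ->
      phi (t *: x + (1 - t) *: y)%R <=
        t%:E * phi x + (1 - t)%:E * phi y
        - (r / 2 * t * (1 - t) * enorm (x - y) ^+ 2)%:E]].

Definition subdifferential (R : realType) (n : nat)
  (phi : 'rV[R]_n -> \bar R) (x : 'rV[R]_n) : set 'rV[R]_n :=
  [set v | phi x \is a fin_num /\
           forall y : 'rV[R]_n, phi x + (dotp v (y - x)%R)%:E <= phi y].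

Definition diff_quotient (R : realType) (n : nat)
  (phi : 'rV[R]_n -> \bar R) (x d : 'rV[R]_n) (t : R) : \bar R :=
  (phi (x + t *: d)%R - phi x) * (t^-1)%:E.

(* For convex phi finite at x the limit exists in \bar R. *)
Definition dirder (R : realType) (n : nat)
  (phi : 'rV[R]_n -> \bar R) (x d : 'rV[R]_n) : \bar R :=
  lim (diff_quotient phi x d t @[t --> 0%R^'+]).

(* The dual addition of \bar R satisfies (+oo) - (+oo) = +oo. *)
Definition dc_fun (R : realType) (n : nat) (g h : 'rV[R]_n -> \bar R)
  (x : 'rV[R]_n) : \bar R := (g x - h x)%dE.

Definition dc_critical (R : realType) (n : nat) (g h : 'rV[R]_n -> \bar R)
  (x : 'rV[R]_n) : Prop :=
  subdifferential g x `&` subdifferential h x !=set0.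

(* The difference quotient of g - h is required to converge, since lim has a
   junk value otherwise. *)
Definition dir_stationary (R : realType) (n : nat) (g h : 'rV[R]_n -> \bar R)
  (x : 'rV[R]_n) : Prop :=
  dc_fun g h x \is a fin_num /\
  forall d : 'rV[R]_n,
    [/\ cvg (diff_quotient (dc_fun g h) x d t @[t --> 0%R^'+]),
        dirder (dc_fun g h) x d = (dirder g x d - dirder h x d)%dE
      & 0 <= dirder (dc_fun g h) x d].

(* Continuity at a point of an extended real-valued convex function includes
   finiteness at that point. *)
Definition econtinuous_at (R : realType) (n : nat) (phi : 'rV[R]_n -> \bar R)
  (x : 'rV[R]_n) : Prop :=
  phi x \is a fin_num /\ {for x, continuous phi}.

Definition subseq_cvg (R : realType) (n : nat) (x : nat -> 'rV[R]_n)
  (l : nat -> nat) (a : 'rV[R]_n) : Prop :=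
  increasing_seq l /\ x (l k) @[k --> \oo] --> a.

Definition seq_limit_point (R : realType) (n : nat) (x : nat -> 'rV[R]_n)
  (a : 'rV[R]_n) : Prop := exists l : nat -> nat, subseq_cvg x l a.

(* Maxima and minima over the index set are taken in \bar R, with -oo resp.
   +oo over the empty set; the clause \max_i h_i(x) = h(x) with h(x) <> -oo
   thus forces the index set to be nonempty. *)
Definition minorant_family (R : realType) (n : nat) (h : 'rV[R]_n -> \bar R)
  (x : 'rV[R]_n) (I : finType) (hs : I -> 'rV[R]_n -> R) : Prop :=
  [/\ forall (i : I) (y : 'rV[R]_n), differentiable (hs i) y,
      forall i : I, convex_efun (EFin \o hs i),
      \big[maxe/-oo]_(i : I) (hs i x)%:E = h x
    & forall y : 'rV[R]_n, \big[maxe/-oo]_(i : I) (hs i y)%:E <= h y].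

Definition subproblem_solution (R : realType) (n : nat)
  (g : 'rV[R]_n -> \bar R) (v z : 'rV[R]_n) : Prop :=
  forall y : 'rV[R]_n, g z - (dotp v z)%:E <= g y - (dotp v y)%:E.

Definition algorithm_update (R : realType) (n : nat) (g : 'rV[R]_n -> \bar R)
  (I : finType) (hs : I -> 'rV[R]_n -> R) (x xnext : 'rV[R]_n) : Prop :=
  exists z : I -> 'rV[R]_n,
    (forall i : I, subproblem_solution g (grad (hs i) x) (z i)) /\
    let value i := g (z i) - (dotp (grad (hs i) x) (z i - x)%R)%:E
                   - (hs i x)%:E in
    exists i : I, (forall j : I, value i <= value j) /\ xnext = z i.

(* I k and hs k are the index set and the family chosen at iteration k. *)
Definition algorithm_sequence (R : realType) (n : nat)
  (g h : 'rV[R]_n -> \bar R) (x : nat -> 'rV[R]_n)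
  (I : nat -> finType) (hs : forall k, I k -> 'rV[R]_n -> R) : Prop :=
  subdifferential h (x 0%N) !=set0 /\
  forall k : nat, minorant_family h (x k) (hs k) /\
                  algorithm_update g (hs k) (x k) (x k.+1).

Definition min_modulus (R : realType) (n : nat) (I : finType)
  (hs : I -> 'rV[R]_n -> R) : \bar R :=
  \big[mine/+oo]_(i : I) convexity_modulus (EFin \o hs i).

(* Main.v *)
From mathcomp Require Import ring lra.
Require Import Defs.

(** Why the theorem holds. One iteration builds at [x^k] the minorant
    [max_i (h_i(x^k) + <grad h_i(x^k), . - x^k>)] of [h], and the selection rule
    makes [x^(k+1)] a minimizer of [g] minus this model. Therefore, for all [y]
    and all indices [j],
      [f(x^(k+1)) + rho_k / 2 * |x^(k+1) - x^k|^2
          <= g(y) - <grad h_j(x^k), y - x^k> - h_j(x^k)]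
    (lemma [algorithm_update_descent]); the quadratic term is the gain from
    strong convexity of the selected [h_i] over its linearization. Each part of
    the theorem is a specialization of this inequality.

    Part (a) takes [y = x^k] and [j] active at [x^k]: the right-hand side is
    [f(x^k)]. Since [f] is bounded below, the values converge and the steps
    tend to zero when the moduli are bounded away from zero.

    For parts (b) and (c), lower semicontinuity of [g], continuity of [h] at the
    limit point [a], and monotonicity of the values give [f(a) <= f(x^k)] for
    all [k] ([limit_point_le]), so the left-hand side may be replaced by [f(a)].
    For (b), take [j] active at [x^k] and pass to the limit in the bounded
    gradients: the limit is a common subgradient of [g] and [h] at [a]
    ([limit_point_critical]). For (c), take the maximum over [j] and then the
    upper limit: by assumption it dominates [h'(a, y - a) + h(a)], so
    [h'(a, y - a) <= g(y) - g(a)] for all [y], and dividing by the step along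
    each direction gives [h'(a, d) <= g'(a, d)] ([dir_stationary_of_majorant]).
*)

Set Implicit Arguments.
Unset Strict Implicit.
Unset Printing Implicit Defensive.

Local Open Scope classical_set_scope.
Local Open Scope ring_scope.
Local Open Scope ereal_scope.

(** * The Euclidean scalar product *)

Lemma dotpBr (R : realType) (n : nat) (u v w : 'rV[R]_n) :
  (dotp u (v - w) = dotp u v - dotp u w)%R.
Proof.
by rewrite /dotp -sumrB; apply: eq_bigr => j _; rewrite !mxE mulrBr.
Qed.

Lemma dotpr0 (R : realType) (n : nat) (u : 'rV[R]_n) : dotp u 0%R = 0%R.
Proof. by rewrite -[0%R in LHS](subrr u) dotpBr subrr. Qed.

Lemma abs_coord_le_enorm (R : realType) (n : nat) (u : 'rV[R]_n) (j : 'I_n) :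
  (`|u ord0 j| <= enorm u)%R.
Proof.
rewrite -sqrtr_sqr; apply: ler_wsqrtr.
rewrite /dotp (bigD1 j) //= -expr2 lerDl.
by apply: sumr_ge0 => i _; rewrite -expr2 sqr_ge0.
Qed.

Lemma cvg_dotp (R : realType) (n : nat) (T : Type) (F : set_system T)
  (FF : Filter F) (u v : T -> 'rV[R]_n) (a b : 'rV[R]_n) :
  (forall j, u t ord0 j @[t --> F] --> (a ord0 j : R)) ->
  (forall j, v t ord0 j @[t --> F] --> (b ord0 j : R)) ->
  dotp (u t) (v t) @[t --> F] --> (dotp a b : R).
Proof.
move=> ua vb; rewrite /dotp.
apply: (cvg_big (@add_continuous R)) => i _.
exact: cvgM.
Qed.

(** * Gradients and convexity moduli *)

Lemma derive_grad (R : realType) (n : nat) (f : 'rV[R]_n -> R)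
  (x d : 'rV[R]_n) :
  differentiable f x -> 'D_d f x = dotp (grad f x) d.
Proof.
move=> df; rewrite deriveE // {1}(row_sum_delta d) linear_sum /dotp.
apply: eq_bigr => j _.
by rewrite linearZ /= mxE deriveE // mulrC.
Qed.

(** Divide the strong convexity inequality at [x + t (y - x)] by [t] and let [t]
    tend to [0+]: the difference quotients converge to the gradient term, and
    the factor [1 - t] in front of [c] disappears. The constant [c] stands for
    [r / 2 * |x - y|^2]; with [c = 0] this is the usual gradient inequality. *)
Lemma strongly_convex_gradient (R : realType) (n : nat) (f : 'rV[R]_n -> R)
  (x y : 'rV[R]_n) (c : R) :
  differentiable f x ->
  (forall t : R, 0 <= t <= 1 ->
     f (t *: y + (1 - t) *: x) <= t * f y + (1 - t) * f x - t * (1 - t) * c)%R ->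
  (f x + dotp (grad f x) (y - x) + c <= f y)%R.
Proof.
move=> df fc.
have q_cvg : (t^-1 *: (f (t *: (y - x) + x) - f x))%R @[t --> (0 : R)%R^'+] -->
    (dotp (grad f x) (y - x) : R).
  rewrite -derive_grad //; apply: cvg_dnbhs_at_right.
  exact: (@diff_derivable _ _ _ f x (y - x)%R df).
have b_cvg : (f y - f x - (1 - t) * c)%R @[t --> (0 : R)%R^'+] -->
    (f y - f x - (1 - 0) * c : R)%R.
  apply: cvg_at_right_filter; apply: cvgB; first exact: cvg_cst.
  apply: cvgM; last exact: cvg_cst.
  by apply: cvgB; [exact: cvg_cst|exact: cvg_id].
suff : (dotp (grad f x) (y - x) <= f y - f x - (1 - 0) * c)%R by lra.
apply: (ler_cvg_to q_cvg b_cvg).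
near=> t.
have t0 : (0 < t)%R by near: t; exact: nbhs_right_gt.
have t1 : (t <= 1)%R by near: t; exact: nbhs_right_le.
rewrite /GRing.scale /= mulrC ler_pdivrMr //.
have -> : (t *: (y - x) + x = t *: y + (1 - t) *: x)%R.
  by rewrite scalerBr scalerBl scale1r addrAC addrA.
have /fc : (0 <= t <= 1)%R by rewrite (ltW t0).
nra.
Unshelve. all: by end_near. Qed.

Lemma convex_gradient_le (R : realType) (n : nat) (f : 'rV[R]_n -> R)
  (x y : 'rV[R]_n) :
  convex_efun (EFin \o f) -> differentiable f x ->
  (f x + dotp (grad f x) (y - x) <= f y)%R.
Proof.
move=> fconv df; rewrite -[leLHS]addr0; apply: strongly_convex_gradient => // t.
by move=> /(fconv y x); rewrite /= -!EFinM -EFinD lee_fin mulr0 subr0.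
Qed.

(** Every admissible [r] in the definition of the modulus satisfies this
    inequality, and the right-hand side is a real number independent of [r].
    In particular, when [x != y], the modulus of a finite-valued differentiable
    convex function is finite; this is what keeps the term
    [rho_k / 2 * |x^(k+1) - x^k|^2] finite. *)
Lemma convexity_modulus_gradient (R : realType) (n : nat)
  (f : 'rV[R]_n -> R) (x y : 'rV[R]_n) :
  convex_efun (EFin \o f) -> differentiable f x ->
  convexity_modulus (EFin \o f) * (2^-1)%:E * (enorm (y - x)%R ^+ 2)%:E <=
    (f y - f x - dotp (grad f x) (y - x))%:E.
Proof.
move=> fconv df; rewrite -muleA -EFinM.
have [d0|d_neq0] := eqVneq (enorm (y - x)) 0%R.
  rewrite d0 expr0n /= mulr0 mule0 lee_fin.
  by have := convex_gradient_le y fconv df; lra.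
have d_gt0 : (0 < 2^-1 * enorm (y - x) ^+ 2)%R.
  by rewrite mulr_gt0 ?invr_gt0 // exprn_even_gt0.
rewrite -lee_pdivlMr //; apply: ge_ereal_sup => _ [r [r0 rP] <-].
rewrite lee_pdivlMr // -EFinM lee_fin.
suff : (f x + dotp (grad f x) (y - x) + r * (2^-1 * enorm (y - x) ^+ 2) <=
        f y)%R by lra.
apply: strongly_convex_gradient => // t /(rP y x).
rewrite /= -!EFinM -!EFinD lee_fin.
by congr (_ <= _)%R; ring.
Qed.

Lemma convexity_modulus_ge0 (R : realType) (n : nat) (phi : 'rV[R]_n -> \bar R) :
  convex_efun phi -> 0 <= convexity_modulus phi.
Proof.
move=> phi_conv; apply: ereal_sup_ubound; exists 0%R => //; split => // x y t t01.
by rewrite !mul0r sube0; exact: phi_conv.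
Qed.

(** * One iteration *)

Lemma subproblem_solution_fin_num (R : realType) (n : nat)
  (g : 'rV[R]_n -> \bar R) (v z y : 'rV[R]_n) :
  (forall u, g u != -oo) -> subproblem_solution g v z -> g y \is a fin_num ->
  g z \is a fin_num.
Proof.
move=> g_proper /(_ y) + gy; rewrite -(fineK gy).
by case: (g z) (g_proper z).
Qed.

Lemma minorant_family_active (R : realType) (n : nat) (h : 'rV[R]_n -> \bar R)
  (x : 'rV[R]_n) (I : finType) (hs : I -> 'rV[R]_n -> R) :
  h x != -oo -> minorant_family h x hs -> exists j, h x = (hs j x)%:E.
Proof.
move=> hx [_ _ hE _].
have : (\big[maxe/-oo]_(i : I) (hs i x)%:E = -oo) \/
       (exists j, \big[maxe/-oo]_(i : I) (hs i x)%:E = (hs j x)%:E).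
  apply: (big_ind (fun u => u = -oo \/ exists j, u = (hs j x)%:E)).
  - by left.
  - by move=> u v uP vP; rewrite /maxe; case: ifP.
  - by move=> i _; right; exists i.
by rewrite hE; case=> // e; rewrite e eqxx in hx.
Qed.

Lemma minorant_family_le (R : realType) (n : nat) (h : 'rV[R]_n -> \bar R)
  (x : 'rV[R]_n) (I : finType) (hs : I -> 'rV[R]_n -> R) (i : I) y :
  minorant_family h x hs -> (hs i y)%:E <= h y.
Proof.
by move=> [_ _ _ /(_ y)]; apply: le_trans; apply: le_bigmax.
Qed.

Lemma min_modulus_ge0 (R : realType) (n : nat) (h : 'rV[R]_n -> \bar R)
  (x : 'rV[R]_n) (I : finType) (hs : I -> 'rV[R]_n -> R) :
  minorant_family h x hs -> 0 <= min_modulus hs.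
Proof.
move=> [_ hs_conv _ _]; apply: le_bigmin => [|i _]; first exact: leey.
exact: convexity_modulus_ge0.
Qed.

(** The one inequality about an iteration from which all three parts follow. If
    [i] is the selected index, then
      [f(x') <= g(x') - h_i(x')
             <= g(x') - h_i(x) - <grad h_i(x), x' - x> - m]
    by strong convexity of [h_i]; the selection rule allows [i] to be replaced
    by any [j] (with its own solution [z_j]), and optimality of [z_j] allows
    [z_j] to be replaced by any [y]. The point [y0] guarantees that the
    subproblems have finite value. *)
Lemma algorithm_update_descent (R : realType) (n : nat)
  (g h : 'rV[R]_n -> \bar R) (x x' y0 : 'rV[R]_n) (I : finType)
  (hs : I -> 'rV[R]_n -> R) :
  (forall u, g u != -oo) -> g y0 \is a fin_num ->
  minorant_family h x hs -> algorithm_update g hs x x' ->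
  exists2 m : R,
    min_modulus hs * (2^-1)%:E * (enorm (x' - x)%R ^+ 2)%:E = m%:E &
    forall (j : I) (y : 'rV[R]_n), dc_fun g h x' + m%:E <=
      g y - (dotp (grad (hs j) x) (y - x) + hs j x)%:E.
Proof.
move=> g_proper gy0 hsP [z [z_sol [i [i_min ->{x'}]]]].
have gz j : g (z j) \is a fin_num.
  exact: subproblem_solution_fin_num g_proper (z_sol j) gy0.
have [hs_diff hs_conv _ _] := hsP.
set M := min_modulus hs * _ * _.
have M_ge0 : 0 <= M.
  by rewrite /M !mule_ge0 ?lee_fin ?invr_ge0 ?sqr_ge0 ?(min_modulus_ge0 hsP).
have M_le : M <= (hs i (z i) - hs i x - dotp (grad (hs i) x) (z i - x))%:E.
  apply: le_trans (convexity_modulus_gradient _ (hs_conv i) (hs_diff i x)).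
  rewrite /M !lee_wpmul2r ?lee_fin ?invr_ge0 ?sqr_ge0 //.
  exact: bigmin_le.
have M_fin : M \is a fin_num.
  by rewrite ge0_fin_numE //; apply: le_lt_trans M_le _; exact: ltry.
exists (fine M) => [|j y]; first by rewrite fineK.
move: M_le; rewrite -[in X in X -> _](fineK M_fin) lee_fin => m_le.
have dc_le : dc_fun g h (z i) <= (fine (g (z i)) - hs i (z i))%:E.
  have := minorant_family_le i (z i) hsP.
  rewrite /dc_fun -{1}(fineK (gz i)); case: (h (z i)) => //= r.
    rewrite lee_fin => ir.
    change (fine (g (z i)) - r <= fine (g (z i)) - hs i (z i))%R; lra.
  by rewrite leNye.
have := z_sol j y; have := i_min j.
have := g_proper y; case: (g y) => [b _| _|//]; last by move=> *; exact: leey.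
rewrite -(fineK (gz i)) -(fineK (gz j)) !lee_fin !dotpBr in m_le *.
move=> ij jy; apply: (le_trans (leeD dc_le (lexx _))).
rewrite lee_fin; lra.
Qed.

(** * Directional derivatives of convex functions *)

Lemma diff_quotient_fin (R : realType) (n : nat) (phi : 'rV[R]_n -> \bar R)
  (x d : 'rV[R]_n) (t a b : R) :
  phi x = a%:E -> phi (x + t *: d)%R = b%:E ->
  diff_quotient phi x d t = ((b - a) / t)%:E.
Proof. by rewrite /diff_quotient => -> ->. Qed.

Lemma diff_quotient_y (R : realType) (n : nat) (phi : 'rV[R]_n -> \bar R)
  (x d : 'rV[R]_n) (t : R) :
  phi x \is a fin_num -> (0 < t)%R -> phi (x + t *: d)%R = +oo ->
  diff_quotient phi x d t = +oo.
Proof.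
rewrite /diff_quotient => xfin t0 ->; rewrite -(fineK xfin) /=.
by rewrite gt0_mulye // lte_fin invr_gt0.
Qed.

(** The point [x + s d] is the convex combination of [x + t d] and [x] with
    weight [s / t]. *)
Lemma diff_quotient_homo (R : realType) (n : nat) (phi : 'rV[R]_n -> \bar R)
  (x d : 'rV[R]_n) (s t : R) :
  (forall y, phi y != -oo) -> convex_efun phi -> phi x \is a fin_num ->
  (0 < s)%R -> (s <= t)%R -> diff_quotient phi x d s <= diff_quotient phi x d t.
Proof.
move=> phi_proper phi_conv xfin s0 st.
have t0 : (0 < t)%R by exact: lt_le_trans st.
case xtE : (phi (x + t *: d)%R) (phi_proper (x + t *: d)%R) => [b| |//] _;
  last by rewrite (diff_quotient_y xfin t0 xtE) leey.
have st01 : (0 <= s / t <= 1)%R.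
  by rewrite divr_ge0 ?(ltW s0) ?(ltW t0) //= ler_pdivrMr ?mul1r.
have := phi_conv (x + t *: d)%R x (s / t)%R st01.
have -> : ((s / t) *: (x + t *: d) + (1 - s / t) *: x = x + s *: d)%R.
  rewrite scalerDr scalerA divfK ?gt_eqF // scalerBl scale1r.
  by rewrite addrC addrA subrK.
rewrite xtE -(fineK xfin) -!EFinM -EFinD.
case xsE : (phi (x + s *: d)%R) (phi_proper (x + s *: d)%R) => [c| |//] _ //.
rewrite (diff_quotient_fin (esym (fineK xfin)) xtE).
rewrite (diff_quotient_fin (esym (fineK xfin)) xsE) !lee_fin => cP.
rewrite ler_pdivrMr // mulrAC.
suff : (c - fine (phi x) <= s / t * (b - fine (phi x)))%R.
  by rewrite mulrC mulrA mulrAC.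
by lra.
Qed.

Lemma diff_quotient_cvg_inf (R : realType) (n : nat) (phi : 'rV[R]_n -> \bar R)
  (x d : 'rV[R]_n) :
  (forall y, phi y != -oo) -> convex_efun phi -> phi x \is a fin_num ->
  diff_quotient phi x d t @[t --> (0 : R)%R^'+] -->
    ereal_inf [set diff_quotient phi x d t | t in `]0%R, +oo[].
Proof.
move=> phi_proper phi_conv xfin; apply: nondecreasing_at_right_cvge => //.
move=> s t; rewrite !in_itv /= !andbT => s0 t0; exact: diff_quotient_homo.
Qed.

(** By monotonicity the limit of the difference quotients at [0+] is their
    infimum. All later bounds on directional derivatives use this description
    instead of the limit. *)
Lemma dirderE (R : realType) (n : nat) (phi : 'rV[R]_n -> \bar R)
  (x d : 'rV[R]_n) :
  (forall y, phi y != -oo) -> convex_efun phi -> phi x \is a fin_num ->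
  dirder phi x d = ereal_inf [set diff_quotient phi x d t | t in `]0%R, +oo[].
Proof.
by move=> *; apply/cvg_lim => //; exact: diff_quotient_cvg_inf.
Qed.

Lemma dirder_le (R : realType) (n : nat) (phi : 'rV[R]_n -> \bar R)
  (x d : 'rV[R]_n) (t : R) :
  (forall y, phi y != -oo) -> convex_efun phi -> phi x \is a fin_num ->
  (0 < t)%R -> dirder phi x d <= diff_quotient phi x d t.
Proof.
move=> *; rewrite dirderE //; apply: ereal_inf_lbound; exists t => //=.
by rewrite in_itv /= andbT.
Qed.

Lemma dirder_ge (R : realType) (n : nat) (phi : 'rV[R]_n -> \bar R)
  (x d : 'rV[R]_n) (c : \bar R) :
  (forall y, phi y != -oo) -> convex_efun phi -> phi x \is a fin_num ->
  (forall t : R, (0 < t)%R -> c <= diff_quotient phi x d t) ->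
  c <= dirder phi x d.
Proof.
move=> ? ? ? cP; rewrite dirderE //; apply: le_ereal_inf_tmp => _ [t /= + <-].
by rewrite in_itv /= andbT; exact: cP.
Qed.

(** The half of positive homogeneity that turns a bound on the derivative along
    [s d] into a bound on the difference quotient with step [s]. *)
Lemma dirderZ_ge (R : realType) (n : nat) (phi : 'rV[R]_n -> \bar R)
  (x d : 'rV[R]_n) (s : R) :
  (forall y, phi y != -oo) -> convex_efun phi -> phi x \is a fin_num ->
  (0 < s)%R -> s%:E * dirder phi x d <= dirder phi x (s *: d)%R.
Proof.
move=> phi_proper phi_conv xfin s0; apply: dirder_ge => // t t0.
have -> : diff_quotient phi x (s *: d) t = s%:E * diff_quotient phi x d (t * s).
  rewrite /diff_quotient scalerA [RHS]muleC -muleA -EFinM invfM divfK //.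
  by rewrite gt_eqF.
by rewrite lee_pmul2l ?lte_fin // dirder_le // mulr_gt0.
Qed.

Lemma cvg_ray (R : realType) (n : nat) (x d : 'rV[R]_n) :
  (x + t *: d)%R @[t --> (0 : R)%R^'+] --> x.
Proof.
apply: cvg_at_right_filter; rewrite -[X in _ --> X]addr0 -(scale0r d).
apply: cvgD; first exact: cvg_cst.
by apply: cvgZr_tmp; exact: cvg_id.
Qed.

Lemma near_ray_fin_num (R : realType) (n : nat) (phi : 'rV[R]_n -> \bar R)
  (x d : 'rV[R]_n) :
  econtinuous_at phi x ->
  \forall t \near (0 : R)%R^'+, phi (x + t *: d)%R \is a fin_num.
Proof.
move=> [xfin phi_cont].
have : phi (x + t *: d)%R @[t --> (0 : R)%R^'+] --> (fine (phi x))%:E.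
  by rewrite fineK //; apply: continuous_cvg; [exact: phi_cont|exact: cvg_ray].
by move=> /fine_cvgP[].
Qed.

(** Pick [t > 0] with [phi] finite at both [x + t d] and [x - t d]. The
    derivative is at most the quotient with step [t]; and since [x] lies between
    [x - t d] and [x + s d], every forward quotient is at least minus the
    quotient with step [t] in direction [- d]. *)
Lemma dirder_fin_num (R : realType) (n : nat) (phi : 'rV[R]_n -> \bar R)
  (x d : 'rV[R]_n) :
  (forall y, phi y != -oo) -> convex_efun phi -> econtinuous_at phi x ->
  dirder phi x d \is a fin_num.
Proof.
move=> phi_proper phi_conv phi_cont; have [xfin _] := phi_cont.
have [t [t0 [t_fin tN_fin]]] : exists t : R, [/\ (0 < t)%R &
    phi (x + t *: d)%R \is a fin_num /\ phi (x + t *: (- d))%R \is a fin_num].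
  near (0 : R)%R^'+ => t; exists t; split.
    by near: t; exact: nbhs_right_gt.
  by split; near: t; exact: near_ray_fin_num.
rewrite fin_real //; apply/andP; split.
  apply: (@lt_le_trans _ _
    (- ((fine (phi (x + t *: (- d))%R) - fine (phi x)) / t))%:E).
    exact: ltNyr.
  apply: dirder_ge => // s s0.
  case xsE : (phi (x + s *: d)%R) (phi_proper (x + s *: d)%R) => [b| |//] _;
    last by rewrite (diff_quotient_y xfin s0 xsE) leey.
  rewrite (diff_quotient_fin (esym (fineK xfin)) xsE) lee_fin.
  have ts0 : (0 < t + s)%R by rewrite addr_gt0.
  have l01 : (0 <= t / (t + s) <= 1)%R.
    rewrite divr_ge0 ?(ltW t0) ?(ltW ts0) //=.
    by rewrite ler_pdivrMr ?mul1r ?lerDl ?(ltW s0).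
  (* x is the combination of x + s d and x - t d with weight t / (t + s) *)
  have := phi_conv (x + s *: d)%R (x + t *: (- d))%R _ l01.
  have lE : (1 - t / (t + s) = s / (t + s))%R by field; lra.
  have -> : (t / (t + s) *: (x + s *: d) +
             (1 - t / (t + s)) *: (x + t *: - d) = x)%R.
    rewrite !scalerDr addrACA -scalerDl addrC -[RHS]add0r; congr (_ + _)%R.
      rewrite scalerN !scalerN !scalerA -scalerBl lE.
      by rewrite [X in X *: _](_ : _ = 0)%R ?scale0r //; ring.
    by rewrite addrC subrK scale1r.
  rewrite xsE lE -(fineK xfin) -(fineK tN_fin) -!EFinM -EFinD lee_fin /=.
  set p := fine _; set q := fine _ => pP.
  rewrite -subr_ge0.
  have -> : ((b - p) / s - - ((q - p) / t) =
     (t + s) / (t * s) * ((t / (t + s) * b + s / (t + s) * q) - p))%R.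
    by field; lra.
  by rewrite mulr_ge0 ?subr_ge0 // divr_ge0 ?ltW // mulr_gt0.
apply: (le_lt_trans (dirder_le d phi_proper phi_conv xfin t0)).
rewrite (diff_quotient_fin (esym (fineK xfin)) (esym (fineK t_fin))).
exact: ltry.
Unshelve. all: by end_near. Qed.

(** The hypothesis says that [x] minimizes [g] minus the model
    [y |-> h'(x, y - x)] of [h]. Taking [y = x + t d], dividing by [t] and using
    homogeneity gives [h'(x, d) <= g'(x, d)]. As [h'(x, d)] is finite, the
    quotients of [g - h] are, for small [t], differences of those of [g] and
    [h], and the limits may be subtracted even if [g'(x, d) = +oo]. *)
Lemma dir_stationary_of_majorant (R : realType) (n : nat)
  (g h : 'rV[R]_n -> \bar R) (x : 'rV[R]_n) :
  (forall y, g y != -oo) -> (forall y, h y != -oo) ->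
  convex_efun g -> convex_efun h -> g x \is a fin_num -> econtinuous_at h x ->
  (forall y, dirder h x (y - x)%R + g x <= g y) ->
  dir_stationary g h x.
Proof.
move=> g_proper h_proper g_conv h_conv gx h_cont h_le; have [hx _] := h_cont.
have fx : dc_fun g h x = (fine (g x) - fine (h x))%:E.
  by rewrite /dc_fun -{1}(fineK gx) -{1}(fineK hx).
split=> [|d]; first by rewrite fx.
have hd : dirder h x d \is a fin_num by exact: dirder_fin_num.
have g_ge t : (0 < t)%R -> dirder h x d <= diff_quotient g x d t.
  move=> t0; rewrite /diff_quotient lee_pdivlMr // leeBrDr // muleC.
  apply: le_trans (h_le (x + t *: d)%R); rewrite addrAC subrr add0r leeD2r //.
  exact: dirderZ_ge.
have cvg_g : diff_quotient g x d t @[t --> (0 : R)%R^'+] --> dirder g x d.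
  by rewrite dirderE //; exact: diff_quotient_cvg_inf.
have cvg_h : diff_quotient h x d t @[t --> (0 : R)%R^'+] --> dirder h x d.
  by rewrite dirderE //; exact: diff_quotient_cvg_inf.
have cvg_f : diff_quotient (dc_fun g h) x d t @[t --> (0 : R)%R^'+] -->
    dirder g x d - dirder h x d.
  apply: cvg_trans (cvgeB _ cvg_g cvg_h); last first.
    by rewrite fin_num_adde_defl // fin_numN.
  apply: near_eq_cvg; near=> t.
  have t0 : (0 < t)%R by near: t; exact: nbhs_right_gt.
  have ht : h (x + t *: d)%R \is a fin_num by near: t; exact: near_ray_fin_num.
  rewrite (diff_quotient_fin (esym (fineK hx)) (esym (fineK ht))).
  case gtE : (g (x + t *: d)%R) (g_proper (x + t *: d)%R) => [b| |//] _.
    rewrite (diff_quotient_fin (esym (fineK gx)) gtE).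
    have ftE : dc_fun g h (x + t *: d)%R = (b - fine (h (x + t *: d)%R))%:E.
      by rewrite /dc_fun gtE -{1}(fineK ht).
    rewrite (diff_quotient_fin fx ftE) -EFinB; congr EFin.
    by rewrite -mulrBl; congr (_ / _)%R; ring.
  rewrite (diff_quotient_y gx t0 gtE) diff_quotient_y //; first by rewrite fx.
  by rewrite /dc_fun gtE -(fineK ht).
have dirder_f : dirder (dc_fun g h) x d = dirder g x d - dirder h x d.
  exact/cvg_lim.
split.
- by apply/cvg_ex; exists (dirder g x d - dirder h x d).
- by rewrite dirder_f -(fineK hd); case: (dirder g x d).
- by rewrite dirder_f sube_ge0 ?hd //; exact: dirder_ge.
Unshelve. all: by end_near. Qed.

(** * Limits along filters *)

Lemma lower_semicontinuous_le_lim (R : realType) (n : nat)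
  (phi : 'rV[R]_n -> \bar R) (T : Type) (F : set_system T)
  (FF : ProperFilter F) (u : T -> 'rV[R]_n) (b : T -> R) (a : 'rV[R]_n)
  (c : R) :
  lower_semicontinuous phi -> u t @[t --> F] --> a -> b t @[t --> F] --> c ->
  (\forall t \near F, phi (u t) <= (b t)%:E) -> phi a <= c%:E.
Proof.
move=> phi_lsc ua bc ub; rewrite leNgt; apply/negP => c_lt.
have [r cr r_lt] : exists2 r : R, (c < r)%R & r%:E < phi a.
  case: (phi a) c_lt => [s| |//]; last by exists (c + 1)%R; rewrite ?ltry ?ltrDl.
  by rewrite lte_fin => cs; exists ((c + s) / 2)%R; rewrite ?lte_fin; lra.
have [V aV Vr] := phi_lsc _ _ r_lt.
have F_false : \forall t \near F, False.
  near=> t.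
  have br : (b t <= r)%R by near: t; exact: (cvgr_le _ bc).
  have utb : phi (u t) <= (b t)%:E by near: t.
  have : V (u t) by near: t; exact: ua.
  move=> /Vr /lt_le_trans /(_ utb); rewrite lte_fin => /lt_le_trans /(_ br).
  by rewrite ltxx.
by have [] := filter_ex F_false.
Unshelve. all: by end_near. Qed.

Lemma fmap_ultra (T U : Type) (f : T -> U) (F : set_system T) :
  UltraFilter F -> UltraFilter (f @ F).
Proof.
move=> FU; split=> [|G GG FG]; first exact: fmap_proper_filter.
rewrite eqEsubset; split=> // A GA.
have [//|FNA] := in_ultra_setVsetC (f @^-1` A) FU.
have GNA : G (~` A) by exact: FG.
have := filterI GA GNA; rewrite setICr => G0.
by case: (@filter_not_empty _ G _); exact: G0.
Qed.

(** Ultrafilters play the role of subsequences: along an ultrafilter finer than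
    [\oo] all bounded real sequences converge simultaneously. *)
Lemma bounded_ultra_cvg (R : realType) (T : Type) (F : set_system T)
  (u : T -> R) (M : R) :
  UltraFilter F -> (forall t, `|u t| <= M)%R ->
  exists l : R, u t @[t --> F] --> l.
Proof.
move=> FU uM.
have := @segment_compact R (- M) M; rewrite compact_ultra => cM.
have [||l [_ ul]] := cM (u @ F).
- exact: fmap_ultra.
- by apply: (@filterE _ F) => t /=; rewrite in_itv /= -ler_norml uM.
- by exists l.
Qed.

Lemma increasing_seq_ge (l : nat -> nat) : increasing_seq l ->
  forall k, (k <= l k)%N.
Proof.
move=> l_incr; elim=> // k kl; apply: leq_ltn_trans kl _.
by rewrite ltnNge -leEnat l_incr ltnn.
Qed.

(** * The iterates *)

Section Iterates.
Context (R : realType) (n : nat) (g h : 'rV[R]_n -> \bar R)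
  (x : nat -> 'rV[R]_n) (I : nat -> finType)
  (hs : forall k : nat, I k -> 'rV[R]_n -> R)
  (g_proper : forall y : 'rV[R]_n, g y != -oo)
  (h_proper : forall y : 'rV[R]_n, h y != -oo)
  (x_gen : algorithm_sequence g h x hs) (y0 : 'rV[R]_n)
  (gy0 : g y0 \is a fin_num).
Arguments hs : clear implicits.

Lemma h_iterate_fin_num k : h (x k) \is a fin_num.
Proof.
by have [_ /(_ k)[/minorant_family_active -/(_ (h_proper _))[j ->]]] := x_gen.
Qed.

Lemma g_iterate_fin_num k : g (x k.+1) \is a fin_num.
Proof.
have [_ /(_ k)[_ [z [z_sol [i [_ ->]]]]]] := x_gen.
exact: subproblem_solution_fin_num g_proper (z_sol i) gy0.
Qed.

Lemma dc_fun_fin_num y : g y \is a fin_num -> h y \is a fin_num ->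
  dc_fun g h y = (fine (g y) - fine (h y))%:E.
Proof. by move=> gy hy; rewrite /dc_fun -{1}(fineK gy) -{1}(fineK hy). Qed.

Lemma dc_iterate_fin_num k : dc_fun g h (x k.+1) \is a fin_num.
Proof. by rewrite dc_fun_fin_num ?g_iterate_fin_num ?h_iterate_fin_num. Qed.

Lemma iterate_descent k : exists2 m : R,
    min_modulus (hs k) * (2^-1)%:E * (enorm (x k.+1 - x k)%R ^+ 2)%:E = m%:E &
    dc_fun g h (x k.+1) + m%:E <= dc_fun g h (x k).
Proof.
have [_ /(_ k)[hsP upd]] := x_gen.
have [m mE mP] := algorithm_update_descent g_proper gy0 hsP upd.
have [j hj] := minorant_family_active (h_proper (x k)) hsP.
exists m => //; apply: le_trans (mP j (x k)) _.
rewrite subrr dotpr0 add0r.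
by rewrite /dc_fun hj; case: (g (x k)).
Qed.

Lemma modulus_term_ge0 k :
  0 <= min_modulus (hs k) * (2^-1)%:E * (enorm (x k.+1 - x k)%R ^+ 2)%:E.
Proof.
have [_ /(_ k)[hsP _]] := x_gen.
by rewrite !mule_ge0 ?lee_fin ?invr_ge0 ?sqr_ge0 ?(min_modulus_ge0 hsP).
Qed.

Lemma dc_iterate_decreasing k : dc_fun g h (x k.+1) <= dc_fun g h (x k).
Proof.
have := modulus_term_ge0 k.
have [m -> + m0] := iterate_descent k.
by apply: le_trans; rewrite leeDl.
Qed.

Lemma dc_iterate_homo k m : (k <= m)%N -> dc_fun g h (x m) <= dc_fun g h (x k).
Proof.
elim: m => [|m IH]; first by rewrite leqn0 => /eqP ->.
rewrite leq_eqVlt => /orP[/eqP -> //|km].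
exact: le_trans (dc_iterate_decreasing m) (IH km).
Qed.

Lemma iterate_model_le k (j : I k) y :
  dc_fun g h (x k.+1) <=
    g y - (dotp (grad (hs k j) (x k)) (y - x k) + hs k j (x k))%:E.
Proof.
have [_ /(_ k)[hsP upd]] := x_gen.
have [m mE mP] := algorithm_update_descent g_proper gy0 hsP upd.
apply: le_trans (mP j y); rewrite leeDl // -mE; exact: modulus_term_ge0.
Qed.

(** The values [f(x^(k+1))] decrease and are bounded below by [c], so their
    successive differences, which dominate [r / 2 * |x^(k+2) - x^(k+1)|^2] for
    any real [0 < r <= inf rho_k], tend to zero. The first iterate is skipped
    because [f(x^0)] may be [+oo]. *)
Lemma step_norm_cvg0 (c : R) : (forall y, c%:E <= dc_fun g h y) ->
  0 < ereal_inf (range (fun k : nat => min_modulus (hs k))) ->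
  enorm (x k.+1 - x k)%R @[k --> \oo] --> (0 : R)%R.
Proof.
move=> cP rho_gt0.
have [r r0 r_le] : exists2 r : R, (0 < r)%R &
    r%:E <= ereal_inf (range (fun k : nat => min_modulus (hs k))).
  move: rho_gt0; case: ereal_inf => [s s0| _|//]; first by exists s.
  by exists 1%R; rewrite ?leey.
pose f k := fine (dc_fun g h (x k.+1)).
have fE k : dc_fun g h (x k.+1) = (f k)%:E by rewrite fineK ?dc_iterate_fin_num.
have f_cvg : f k @[k --> \oo] --> inf (range f).
  apply: nonincreasing_cvgn.
    by move=> k m km; rewrite -lee_fin -!fE dc_iterate_homo.
  by exists c => _ [k _ <-]; rewrite -lee_fin -fE.
have f_diff_cvg : (2 / r * (f k - f k.+1))%R @[k --> \oo] --> (0 : R)%R.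
  rewrite [X in _ --> X](_ : _ = 2 / r * (inf (range f) - inf (range f)))%R;
    last by rewrite subrr mulr0.
  apply: cvgM; first exact: cvg_cst.
  by apply: cvgB => //; rewrite (@cvg_shiftS _ f).
have sq_cvg : (enorm (x k.+2 - x k.+1) ^+ 2)%R @[k --> \oo] --> (0 : R)%R.
  apply: (squeeze_cvgr _ (@cvg_cst _ _ _ _ _) f_diff_cvg).
  near=> k; rewrite sqr_ge0 /=.
  have [m mE] := iterate_descent k.+1; rewrite !fE -EFinD lee_fin => mP.
  have : r%:E * (2^-1)%:E * (enorm (x k.+2 - x k.+1)%R ^+ 2)%:E <= m%:E.
    rewrite -mE !lee_wpmul2r ?lee_fin ?invr_ge0 ?sqr_ge0 //.
    by apply: le_trans r_le _; apply: ereal_inf_lbound; exists k.+1.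
  rewrite -!EFinM lee_fin => rm.
  rewrite -ler_pdivrMl ?divr_gt0 // invf_div.
  by lra.
suff step_cvg : enorm (x k.+2 - x k.+1)%R @[k --> \oo] --> (0 : R)%R.
  by rewrite -(@cvg_shiftS _ (fun k => enorm (x k.+1 - x k)%R)).
have := continuous_cvg eventually_filter (@sqrt_continuous R 0%R) sq_cvg.
rewrite sqrtr0; apply: cvg_trans; apply: near_eq_cvg; near=> k => /=.
by rewrite sqrtr_sqr ger0_norm // sqrtr_ge0.
Unshelve. all: by end_near. Qed.

Lemma cvg_h_iterate (F : set_system nat) (FF : Filter F) (l : nat -> nat)
  (a : 'rV[R]_n) : econtinuous_at h a -> x (l k) @[k --> F] --> a ->
  fine (h (x (l k))) @[k --> F] --> (fine (h a) : R).
Proof.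
move=> [ha h_cont] la; apply: fine_cvg; rewrite fineK //.
exact: continuous_cvg.
Qed.

(** Fix [m]. Along the subsequence, eventually
    [g(x^(l k)) <= f(x^m) + h(x^(l k))] by monotonicity of the values; pass to
    the limit using semicontinuity of [g] and continuity of [h]. With [m = 1],
    where [f] is finite, this also shows that [g] is finite at [a]. *)
Lemma limit_point_le (g_lsc : lower_semicontinuous g) (a : 'rV[R]_n) :
  seq_limit_point x a -> econtinuous_at h a ->
  g a \is a fin_num /\ forall m, dc_fun g h a <= dc_fun g h (x m).
Proof.
move=> [l [l_incr la]] h_cont; have [ha _] := h_cont.
have g_le m r : dc_fun g h (x m) = r%:E -> g a <= (r + fine (h a))%:E.
  move=> mE; apply: (@lower_semicontinuous_le_lim _ _ g _ \oo _
    (fun k => x (l k)) (fun k => r + fine (h (x (l k))))%R _ _ g_lsc la).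
    by apply: cvgD; [exact: cvg_cst|exact: cvg_h_iterate la].
  near=> k.
  have mk : (m <= l k)%N.
    apply: leq_trans (increasing_seq_ge l_incr k).
    by near: k; exact: nbhs_infty_ge.
  have := dc_iterate_homo mk.
  rewrite mE /dc_fun -{1}(fineK (h_iterate_fin_num (l k))).
  case: (g (x (l k))) (g_proper (x (l k))) => [b| |//] _ //.
  set p := fine _; change ((b - p)%:E <= r%:E -> b%:E <= (r + p)%:E).
  by rewrite !lee_fin => ?; lra.
have ga : g a \is a fin_num.
  have := g_le 1%N _ (esym (fineK (dc_iterate_fin_num 0))).
  by case: (g a) (g_proper a).
split=> // m; rewrite dc_fun_fin_num //.
have h_fin := h_iterate_fin_num m.
case mE : (dc_fun g h (x m)) => [r| |]; last 2 first.
- by rewrite leey.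
- move: mE; rewrite /dc_fun -(fineK h_fin).
  by case: (g (x m)) (g_proper (x m)).
by have := g_le m r mE; rewrite -(fineK ga) !lee_fin; lra.
Unshelve. all: by end_near. Qed.

(** Let [v_k] be the gradient at [x^k] of a piece active there; it is a
    subgradient of [h] at [x^k], and the descent inequality gives
      [f(a) <= f(x^(k+1)) <= g(y) - <v_k, y - x^k> - h(x^k)].
    Along an ultrafilter refining the subsequence the bounded [v_k] converge
    to some [w]. In the limit the two facts say that [w] is a subgradient at [a]
    of [h] and of [g] respectively. The points [x^(k+1)] need not be close to
    [a], which is why the bound on values is used and not the optimality
    condition [grad h_i(x^k) \in dg(x^(k+1))]. *)
Lemma limit_point_critical (g_lsc : lower_semicontinuous g) (a : 'rV[R]_n)
  (M : R) :
  (forall k i, enorm (grad (hs k i) (x k)) <= M)%R ->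
  seq_limit_point x a -> econtinuous_at h a -> dc_critical g h a.
Proof.
move=> M_bound a_lim h_cont; have [ha _] := h_cont.
have [ga f_le] := limit_point_le g_lsc a_lim h_cont.
have [l [l_incr la]] := a_lim.
have /choice[v vP] : forall k, exists v : 'rV[R]_n, [/\ (enorm v <= M)%R,
    forall y, h (x k) + (dotp v (y - x k)%R)%:E <= h y &
    forall y, dc_fun g h a <= g y - ((dotp v (y - x k)%R)%:E + h (x k))].
  move=> k; have [_ /(_ k)[hsP _]] := x_gen.
  have [j hj] := minorant_family_active (h_proper (x k)) hsP.
  exists (grad (hs k j) (x k)); split=> // y; rewrite hj -EFinD.
    apply: le_trans (minorant_family_le j y hsP); rewrite lee_fin.
    have [hs_diff hs_conv _ _] := hsP.
    exact: convex_gradient_le.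
  exact: le_trans (f_le k.+1) (iterate_model_le j y).
(* refine the subsequence so that all coordinates of the v_k converge *)
have [G [GU oo_sub]] := ultraFilterLemma eventually_filter.
have /choice[w wP] : forall j : 'I_n, exists w : R,
    v (l k) ord0 j @[k --> G] --> w.
  move=> j; apply: (@bounded_ultra_cvg _ _ _ _ M) => // k.
  by have [vM _ _] := vP (l k); exact: le_trans (abs_coord_le_enorm _ _) vM.
have laG : x (l k) @[k --> G] --> a by apply: cvg_trans la; exact: cvg_app.
have hG : fine (h (x (l k))) @[k --> G] --> (fine (h a) : R).
  exact: cvg_h_iterate laG.
have dotpG y : dotp (v (l k)) (y - x (l k))%R @[k --> G] -->
    (dotp (\row_j w j) (y - a)%R : R).
  apply: cvg_dotp => j; first by rewrite mxE; exact: wP.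
  under eq_fun do rewrite !mxE; rewrite !mxE.
  apply: cvgB; first exact: cvg_cst.
  exact: (continuous_cvg _ (@coord_continuous R 1 n ord0 j a) laG).
exists (\row_j w j); split; split=> // y.
  case gy : (g y) (g_proper y) => [b| |//] _; last by rewrite leey.
  have : (dotp (\row_j w j) (y - a) + fine (h a) <=
          b - (fine (g a) - fine (h a)))%R.
    apply: (cvgr_to_le (cvgD (dotpG y) hG)); apply: nearW => k.
    have [_ _ /(_ y)] := vP (l k).
    rewrite gy dc_fun_fin_num // -{1}(fineK (h_iterate_fin_num (l k))).
    rewrite lee_fin => model_le.
    suff : (dotp (v (l k)) (y - x (l k)) + fine (h (x (l k))) <=
            b - (fine (g a) - fine (h a)))%R by [].
    by lra.
  by rewrite -(fineK ga) lee_fin; lra.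
case hy : (h y) (h_proper y) => [b| |//] _; last by rewrite leey.
rewrite -(fineK ha) lee_fin.
apply: (cvgr_to_le (cvgD hG (dotpG y))); apply: nearW => k.
have [_ /(_ y) + _] := vP (l k).
by rewrite hy -{1}(fineK (h_iterate_fin_num (l k))) lee_fin.
Qed.

(** For every [y] and [k] the descent inequality bounds the piecewise linear
    model of [h] at [x^k], evaluated at [y], by [g(y) - f(x^(k+1))], hence by
    [g(y) - f(a)]. The upper limit of the model values obeys the same bound, so
    [h'(a, y - a) + g(a) <= g(y)]. *)
Lemma limit_point_stationary (g_lsc : lower_semicontinuous g)
  (g_convex : convex_efun g) (h_convex : convex_efun h) (a : 'rV[R]_n) :
  seq_limit_point x a -> econtinuous_at h a ->
  (forall y : 'rV[R]_n, exists l : nat -> nat,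
     dirder h a (y - a)%R + h a <=
     limn_esup (fun k : nat => \big[maxe/-oo]_(i : I (l k))
       (dotp (grad (hs (l k) i) (x (l k))) (y - x (l k))
        + hs (l k) i (x (l k)))%:E)) ->
  dir_stationary g h a.
Proof.
move=> a_lim h_cont model; have [ha _] := h_cont.
have [ga f_le] := limit_point_le g_lsc a_lim h_cont.
apply: dir_stationary_of_majorant => // y.
case gy : (g y) (g_proper y) => [b| |//] _; last by rewrite leey.
have [l /le_trans] := model y.
move=> /(_ (b - (fine (g a) - fine (h a)))%:E) H.
have {H} : dirder h a (y - a)%R + h a <= (b - (fine (g a) - fine (h a)))%:E.
  apply: H; rewrite /limn_esup /limf_esup.
  apply: (@le_trans _ _ (ereal_sup (range (fun k : nat =>
    \big[maxe/-oo]_(i : I (l k)) (dotp (grad (hs (l k) i) (x (l k)))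
      (y - x (l k)) + hs (l k) i (x (l k)))%:E)))).
    (* the upper limit is an infimum of suprema over neighbourhoods of \oo *)
    by apply: ereal_inf_lbound; exists setT => //; exact: filterT.
  apply: ge_ereal_sup => _ [k _ <-]; apply: bigmax_le => [|i _].
    exact: leNye.
  have := le_trans (f_le (l k).+1) (iterate_model_le i y).
  by rewrite gy dc_fun_fin_num // !lee_fin; lra.
have := dirder_fin_num (y - a)%R h_proper h_convex h_cont.
move=> /fineK <-; rewrite -(fineK ha) -(fineK ga) !lee_fin; lra.
Qed.

End Iterates.

(** * Convergence of the algorithm *)

Lemma finite_inf_dc_fun (R : realType) (n : nat) (g h : 'rV[R]_n -> \bar R) :
  (forall y, g y != -oo) -> ereal_inf (range (dc_fun g h)) \is a fin_num ->
  (exists y0, g y0 \is a fin_num) /\ exists c : R, forall y, c%:E <= dc_fun g h y.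
Proof.
move=> g_proper alpha_fin; split; last first.
  exists (fine (ereal_inf (range (dc_fun g h)))) => y; rewrite fineK //.
  by apply: ereal_inf_lbound; exists y.
apply: contrapT => /forallNP no_y.
suff : +oo <= ereal_inf (range (dc_fun g h)).
  by move: alpha_fin; case: ereal_inf.
apply: le_ereal_inf_tmp => _ [y _ <-]; rewrite /dc_fun.
by case: (g y) (g_proper y) (no_y y) => [r _ []| |].
Qed.

Theorem theorem3p1 (R : realType) (n : nat) (g h : 'rV[R]_n -> \bar R)
  (x : nat -> 'rV[R]_n) (I : nat -> finType)
  (hs : forall k : nat, I k -> 'rV[R]_n -> R)
  (g_proper : forall y : 'rV[R]_n, g y != -oo)
  (h_proper : forall y : 'rV[R]_n, h y != -oo)
  (g_lsc : lower_semicontinuous g) (h_lsc : lower_semicontinuous h)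
  (g_convex : convex_efun g) (h_convex : convex_efun h)
  (alpha_finite : ereal_inf (range (dc_fun g h)) \is a fin_num)
  (x_gen : algorithm_sequence g h x hs) :
  [/\ (forall k : nat,
         dc_fun g h (x k.+1) <= dc_fun g h (x k)
           - min_modulus (hs k) * (2^-1)%:E * (enorm (x k.+1 - x k)%R ^+ 2)%:E)
      /\ (forall k : nat, dc_fun g h (x k.+1) <= dc_fun g h (x k))
      /\ (0 < ereal_inf (range (fun k : nat => min_modulus (hs k))) ->
          enorm (x k.+1 - x k)%R @[k --> \oo] --> (0 : R)%R),
      ereal_sup (range (fun k : nat =>
          \big[maxe/-oo]_(i : I k) (enorm (grad (hs k i) (x k)))%:E)) < +oo ->
      forall xlim : 'rV[R]_n, seq_limit_point x xlim -> econtinuous_at h xlim ->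
        dc_critical g h xlim
    & forall xlim : 'rV[R]_n, seq_limit_point x xlim -> econtinuous_at h xlim ->
        (forall y : 'rV[R]_n, exists l : nat -> nat,
           subseq_cvg x l xlim /\
           dirder h xlim (y - xlim)%R + h xlim <=
           limn_esup (fun k : nat => \big[maxe/-oo]_(i : I (l k))
             (dotp (grad (hs (l k) i) (x (l k))) (y - x (l k))
              + hs (l k) i (x (l k)))%:E)) ->
        dir_stationary g h xlim].
Proof.
have [[y0 gy0] [c cP]] := finite_inf_dc_fun g_proper alpha_finite.
split.
- split=> [k|].
    have [m -> m_le] := iterate_descent g_proper h_proper x_gen gy0 k.
    by rewrite leeBrDr.
  split=> [k|]; first exact: (dc_iterate_decreasing g_proper h_proper x_gen gy0).
  exact: (step_norm_cvg0 g_proper h_proper x_gen gy0 cP).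
- move=> grad_bound xlim xlim_lim h_cont.
  set S := ereal_sup _ in grad_bound.
  have grad_le k i : (enorm (grad (hs k i) (x k)))%:E <= S.
    apply: le_trans (ereal_sup_ubound _); last by exists k.
    exact: (le_bigmax _ (fun i => (enorm (grad (hs k i) (x k)))%:E)).
  have [M M_bound] : exists M : R,
      forall k i, (enorm (grad (hs k i) (x k)) <= M)%R.
    case: S grad_bound grad_le => [M _| //|_] S_le; [exists M|exists 0%R] => k i.
      by rewrite -lee_fin.
    by have := S_le k i; rewrite leNgt ltNyr.
  by apply: (limit_point_critical g_proper h_proper x_gen gy0 g_lsc M_bound).
- move=> xlim xlim_lim h_cont model.
  apply: (limit_point_stationary g_proper h_proper x_gen gy0) => // y.
  by have [l [_ l_le]] := model y; exists l.
Qed.
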